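(* Let $K$ be a field of characteristic $p>0$. (i) Let $G$ be a finite subgroup of $\mathrm{Aut}_K(K[x])$. Then $G=\widetilde G\rtimes\overline G$ where $\widetilde G=G\cap\mathrm{Sh}(K)=\{\sigma_{1,\mu}\mid\mu\in V\}$, $V\subseteq K$ is a finite dimensional $\mathbb F_p(\lambda_n)$-subspace of $K$, and $\overline G=\langle\sigma_{\lambda_n,(1-\lambda_n)\nu}\rangle$ is a cyclic group of order $n$ where $\lambda_n$ is a primitive $n$'th root of $1$ and $\nu\in K$. In particular, the order of the group $G$ is $np^l$ where $l=\dim_{\mathbb F_p}(V)$ is such that $m\mid l$, where $\mathbb F_p(\lambda_n)=\mathbb F_{p^m}$ for some $m\ge1$. (ii) Conversely, let $\lambda_n\in K$ be a primitive $n$'th root of unity, let $V$ be a finite dimensional $\mathbb F_p(\lambda_n)$-subspace of $K$, and let $\sigma_{\lambda_n,(1-\lambda_n)\nu}$ be an automorphism with $\nu\in K$. Let $\widetilde G:=\{\sigma_{1,\mu}\mid\mu\in V\}$ and $\overline G:=\langle\sigma_{\lambda_n,(1-\lambda_n)\nu}\rangle$. Then the semidirect product $\widetilde G\rtimes\overline G$ is a finite subgroup of $\mathrm{Aut}_K(K[x])$ of order $np^l$ where $l=\dim_{\mathbb F_p}(V)$ is such that $m\mid l$, where $\mathbb F_p(\lambda_n)=\mathbb F_{p^m}$. (iii) The element $\nu\in K$ is unique up to adding an arbitrary element of $V$, i.e. $\widetilde G\rtimes\langle\sigma_{\lambda_n,(1-\lambda_n)\nu}\rangle\simeq\widetilde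 G\rtimes\langle\sigma_{\lambda_n,(1-\lambda_n)\nu'}\rangle$ if and only if $\nu'-\nu\in V$. (iv) Furthermore, $G=\{\sigma_{\lambda_n,(1-\lambda_n)\nu}^i\sigma_{1,v}\mid 0\le i\le n-1,\ v\in V\}$ and $\sigma_{\lambda_n,(1-\lambda_n)\nu}^i\sigma_{1,v}=\sigma_{\lambda_n^i,(1-\lambda_n^i)\nu}\sigma_{1,v}:x\mapsto\lambda_n^ix+(1-\lambda_n^i)\nu+v$.
   Context: $\mathrm{Aut}_K(K[x])=\{\sigma_{\lambda,\mu}\mid\lambda\in K^\times,\mu\in K\}$ is the group of $K$-algebra automorphisms of $K[x]$ under composition, where $\sigma_{\lambda,\mu}(x)=\lambda x+\mu$. $\mathrm{Sh}(K)=\{\sigma_{1,\mu}\mid\mu\in K\}$. $\mathbb F_{p^m}$ is the field with $p^m$ elements. $N\rtimes H$ denotes the (internal) semidirect product with $N$ normal.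
   Formalization: In (iii), ≃ is read as equality of subgroups (as abstract groups they are always isomorphic), and the ''only if'' half is stated for n > 1, since for n = 1 the group does not depend on ν and the claim fails, e.g. for V = 0; the ''if'' half is stated for all n. *)

(* Defs.v *)
From HB Require Import structures.
From mathcomp Require Import all_boot all_algebra.
From mathcomp Require Import boolp classical_sets cardinality.

Set Implicit Arguments.
Unset Strict Implicit.
Unset Printing Implicit Defensive.

Import GRing.Theory.

Local Open Scope classical_set_scope.
Local Open Scope ring_scope.

Section PolynomialAutomorphisms.
Variable K : fieldType.

Definition is_Kalg_automorphism (f : {poly K} -> {poly K}) : Prop :=
  [/\ linear f, GRing.monoid_morphism f & bijective f].

Record polyAut := PolyAut {
  polyAut_fun :> {poly K} -> {poly K};
  polyAutP : is_Kalg_automorphism polyAut_fun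
}.

Lemma polyAut_ext (f g : polyAut) : f =1 g -> f = g.
Proof.
case: f g => [f fP] [g gP] /= /funext fg; subst g.
by rewrite (Prop_irrelevance fP gP).
Qed.

Lemma polyAut_id_subproof : is_Kalg_automorphism idfun.
Proof. by split; [|split|exists idfun]. Qed.

Lemma polyAut_comp_subproof (f g : polyAut) : is_Kalg_automorphism (f \o g).
Proof.
case: f g => [f [fL [f1 fM] fB]] [g [gL [g1 gM] gB]] /=; split.
- by move=> a p q /=; rewrite gL fL.
- by split=> [|p q] /=; [rewrite g1 f1|rewrite gM fM].
- exact: bij_comp.
Qed.

Lemma polyAut_inv_subproof (f : polyAut) :
  exists g : polyAut, cancel f g /\ cancel g f.
Proof.
case: f => [f [fL [f1 fM] fB]]; case: (fB) => g fK gK.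
suff gP : is_Kalg_automorphism g by exists (PolyAut gP).
have f_inj := bij_inj fB; split.
- by move=> a p q; apply: f_inj; rewrite fL !gK.
- by split=> [|p q]; apply: f_inj; rewrite ?fM !gK ?f1.
- by exists f.
Qed.

Definition polyAut_one := PolyAut polyAut_id_subproof.
Definition polyAut_mul (f g : polyAut) := PolyAut (polyAut_comp_subproof f g).
Definition polyAut_inv (f : polyAut) := projT1 (cid (polyAut_inv_subproof f)).

Lemma polyAut_mulA : associative polyAut_mul.
Proof. by move=> f g h; exact: polyAut_ext. Qed.

Lemma polyAut_mul1 : left_id polyAut_one polyAut_mul.
Proof. by move=> f; exact: polyAut_ext. Qed.

Lemma polyAut_mul1r : right_id polyAut_one polyAut_mul.
Proof. by move=> f; exact: polyAut_ext. Qed.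

Lemma polyAut_mulV : left_inverse polyAut_one polyAut_inv polyAut_mul.
Proof.
move=> f; apply: polyAut_ext => p; rewrite /= /polyAut_inv.
by case: cid => g [fK gK] /=; rewrite fK.
Qed.

Lemma polyAut_mulVr : right_inverse polyAut_one polyAut_inv polyAut_mul.
Proof.
move=> f; apply: polyAut_ext => p; rewrite /= /polyAut_inv.
by case: cid => g [fK gK] /=; rewrite gK.
Qed.

HB.instance Definition _ := gen_eqMixin polyAut.
HB.instance Definition _ := gen_choiceMixin polyAut.
HB.instance Definition _ := isGroup.Build polyAut
  polyAut_mulA polyAut_mul1 polyAut_mul1r polyAut_mulV polyAut_mulVr.

Lemma sigma_subproof (lam mu : K) : lam != 0 ->
  is_Kalg_automorphism (fun q => q \Po (lam *: 'X + mu%:P)).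
Proof.
move=> lam0; split.
- by move=> a p q; rewrite comp_polyD comp_polyZ.
- by split=> [|p q]; [rewrite comp_polyC|rewrite comp_polyM].
- exists (fun q => q \Po (lam^-1 *: ('X - mu%:P))) => q; rewrite -comp_polyA.
  + rewrite comp_polyD comp_polyZ comp_polyX comp_polyC.
    by rewrite scalerA divff // scale1r subrK comp_polyXr.
  + rewrite comp_polyZ comp_polyB comp_polyX comp_polyC addrK.
    by rewrite scalerA mulVf // scale1r comp_polyXr.
Qed.

(* A K-algebra endomorphism is determined by the image of 'X, so this is the   *)
(* automorphism sending 'X to lam *: 'X + mu%:P. Products in [polyAut] are     *)
(* compositions, (f * g)%g q = f (g q).                                        *)
Definition sigma (lam mu : K) (lam0 : lam != 0) : polyAut :=
  PolyAut (sigma_subproof mu lam0).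

Arguments sigma : clear implicits.

Lemma sigmaX lam mu (lam0 : lam != 0) :
  sigma lam mu lam0 'X = lam *: 'X + mu%:P.
Proof. by rewrite /= comp_polyX. Qed.

Definition translations (V : set K) : set polyAut :=
  [set sigma 1 mu (oner_neq0 K) | mu in V].

Definition Sh : set polyAut := translations setT.

End PolynomialAutomorphisms.

Arguments sigma {K} lam mu lam0.
Arguments Sh K : clear implicits.

Section Subgroups.
Variable gT : groupType.
Implicit Types G N H A B : set gT.

Definition is_subgroup A : Prop := group_closed [in A].

Definition gen A : set gT := smallest is_subgroup A.

Definition set_mulg A B : set gT := [set (x * y)%g | x in A & y in B].

(* Internal semidirect product: G = N ><| H with N normal in G. *)
Definition is_sdprod N H G : Prop :=
  [/\ [/\ is_subgroup G, is_subgroup N & is_subgroup H],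
      N `<=` G /\ {in G & N, forall g u, (u ^ g)%g \in N},
      N `&` H = [set 1%g]
    & set_mulg N H = G].

End Subgroups.

Section Subspaces.
Variable K : fieldType.
Implicit Types F V : set K.

Definition is_subfield F : Prop := GRing.divring_closed [in F].

Definition prime_subfield : set K := smallest is_subfield set0.

(* For K of characteristic p, the subfield F_p(lam) of K. *)
Definition Fp_adjoin (lam : K) : set K :=
  smallest is_subfield (prime_subfield `|` [set lam]).

Definition is_subspace F V : Prop :=
  [/\ 0 \in V, {in V &, forall u v, u + v \in V}
    & {in F & V, forall a v, a * v \in V}].

Definition is_basis F V d (e : 'I_d -> K) : Prop :=
  (forall i, e i \in V) /\
  {in V, forall v, exists! c : {ffun 'I_d -> K},
    (forall i, c i \in F) /\ v = \sum_(i < d) c i * e i}.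

Definition has_dim F V (d : nat) : Prop :=
  exists e : 'I_d -> K, is_basis F V e.

Definition is_fd_subspace F V : Prop :=
  is_subspace F V /\ exists d, has_dim F V d.

End Subspaces.

Arguments prime_subfield K : clear implicits.

(* Main.v *)
(* A K-automorphism f of K[x] sends x to an affine polynomial
   a x + b with a <> 0, and f |-> a is a homomorphism to K^* whose kernel is Sh K.
   For a finite subgroup G the image is a finite group of units of K, hence
   consists of the powers of a primitive n-th root of unity lam, and the kernel is
   a finite additive group V. An element of G above lam fixes some point nu (or can
   be taken to be 1 when lam = 1), and f belongs to G iff a^n = 1 and the defect
   b - (1 - a) nu lies in V. Conjugation by that element shows lam V = V; the
   multipliers {a | a V <= V} of a finite group V form a subfield, so V is a vector
   space over F_p(lam). That field is finite because lam is fixed by a power of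
   the Frobenius, and counting V over F_p and over F_p(lam) gives m | l. *)
Require Import Defs.
From mathcomp Require Import all_boot all_algebra.
From mathcomp Require Import cyclic ring.
From mathcomp Require Import boolp classical_sets cardinality.
Import GRing.Theory.

Set Implicit Arguments.
Unset Strict Implicit.
Unset Printing Implicit Defensive.

Local Open Scope classical_set_scope.
Local Open Scope ring_scope.
Local Open Scope card_scope.

(** * Finite sets as duplicate-free lists, and their cardinalities *)

Lemma card_set_seq (T : eqType) (s : seq T) : uniq s -> [set` s] #= `I_(size s).
Proof.
(* The empty list is treated apart because [nth] needs a default element of [T], here the head of
   the list. *)
case: s => [|x0 s'] Us; first by rewrite /= II0 (_ : [set` _] = set0) //; apply/seteqP; split.
move: {s'}(x0 :: s') Us => s Us.
have -> : [set` s] = [set nth x0 s i | i in `I_(size s)].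
  apply/seteqP; split=> [x /= xs|_ [i /= ilt <-]]; last exact: mem_nth.
  exists (index x s); [by rewrite /= index_mem|exact: nth_index].
apply: inj_card_eq => i j; rewrite !in_setE /= => ilt jlt /eqP.
by rewrite nth_uniq // => /eqP.
Qed.

Lemma card_set_seqP (T : eqType) (A : set T) n :
  A #= `I_n <-> exists s, [/\ uniq s, size s = n & A = [set` s]].
Proof.
split=> [An|[s [Us <- ->]]]; last exact: card_set_seq.
have /finite_seqP[s As] : finite_set A by apply/finite_setP; exists n.
have Au : A = [set` undup s] by rewrite As; apply/seteqP; split=> x /=; rewrite mem_undup.
exists (undup s); split; rewrite ?undup_uniq //.
apply/card_eq_II; apply: card_eq_trans An; rewrite card_eq_sym Au.
by apply: card_set_seq; rewrite undup_uniq.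
Qed.

Lemma card_range_fin (T : finType) (U : eqType) (h : T -> U) :
  injective h -> range h #= `I_#|T|.
Proof.
move=> h_inj; apply/card_set_seqP; exists (codom h); split.
- by rewrite map_inj_uniq ?enum_uniq.
- exact: size_codom.
apply/seteqP; split=> x /=; first by case=> y _ <-; apply: codom_f.
by case/codomP=> y ->; exists y.
Qed.

(** * Bases over finite subfields *)

Section Subspaces.
Variable K : fieldType.
Implicit Types F V : set K.

Definition spans F V d (e : 'I_d -> K) : Prop :=
  (forall i, e i \in V) /\
  forall v, v \in V -> exists c : 'I_d -> K,
    (forall i, c i \in F) /\ v = \sum_(i < d) c i * e i.

Lemma subfieldE F : is_subfield F ->
  [/\ 0 \in F, 1 \in F, {in F &, forall u v, u + v \in F},
      {in F, forall u, - u \in F} &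
      {in F &, forall u v, u * v \in F} /\ {in F, forall u, u^-1 \in F}].
Proof.
move=> [F1 FB Fdiv].
have F0 : 0 \in F by rewrite -(subrr 1); apply: FB.
have FN : {in F, forall u, - u \in F} by move=> u Fu; rewrite -sub0r; apply: FB.
have FV : {in F, forall u, u^-1 \in F} by move=> u Fu; rewrite -div1r; apply: Fdiv.
split=> //; first by move=> u v Fu Fv; rewrite -(opprK v); apply: FB => //; apply: FN.
by split=> // u v Fu Fv; rewrite -(invrK v); apply: Fdiv => //; apply: FV.
Qed.

(** All elements of [V] together span [V], with coefficients 0 and 1. *)
Lemma spans_finite F V : is_subfield F -> finite_set V ->
  exists d (e : 'I_d -> K), spans F V e.
Proof.
move=> /subfieldE[F0 F1 _ _ _] /finite_seqP[s ->].
exists (size s), (fun i => nth 0 s i); split=> [i|v].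
  by rewrite in_setE /=; apply: mem_nth.
rewrite in_setE /= => vs; have lt_v : (index v s < size s)%N by rewrite index_mem.
exists (fun i => (i == Ordinal lt_v)%:R); split=> [i|]; first by case: eqP.
rewrite (bigD1 (Ordinal lt_v)) //= eqxx mul1r nth_index // big1 ?addr0 // => i /negPf->.
by rewrite mul0r.
Qed.

(* A nontrivial relation lets one drop a spanning vector, so a spanning family
   of minimal length is a basis. *)
Lemma spans_lift F V d (e : 'I_d.+1 -> K) (c : 'I_d.+1 -> K) k :
  is_subfield F -> spans F V e -> (forall i, c i \in F) -> c k != 0 ->
  \sum_(i < d.+1) c i * e i = 0 -> spans F V (fun j => e (lift k j)).
Proof.
move=> /subfieldE[F0 F1 FD FN [FM FV]] [Ve eV] cF ck0 ce0.
split=> [j|v /eV[b [bF ->]]]; first exact: Ve.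
exists (fun j => b (lift k j) - b k * (c (lift k j) / c k)).
split=> [j|]; first by apply: FD => //; apply: FN; apply: (FM) => //; apply: FM => //; apply: FV.
move: ce0; rewrite !(bigD1_ord k) //= => /eqP; rewrite addr_eq0 => /eqP cke.
have -> : e k = - \sum_(i < d) (c (lift k i) / c k) * e (lift k i).
  apply: (mulfI ck0); rewrite cke mulrN mulr_sumr; congr (- _).
  by apply: eq_bigr => i _; rewrite mulrA mulrCA divff // mulr1.
rewrite mulrN mulr_sumr addrC -sumrB; apply: eq_bigr => i _.
by rewrite mulrBl -!mulrA.
Qed.

Lemma has_dim_finite F V : is_subfield F -> is_subspace F V -> finite_set V ->
  exists d, has_dim F V d.
Proof.
move=> Fsub VP Vfin.
pose P d := `[< exists e : 'I_d -> K, spans F V e >].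
have exP : exists d, P d.
  by have [d [e eP]] := spans_finite Fsub Vfin; exists d; apply/asboolP; exists e.
case: (ex_minnP exP) => d /asboolP[e eP] dmin.
exists d, e; split=> [|v Vv]; first by case: eP.
have [_ _ FD FN _] := subfieldE Fsub.
have [_ /(_ _ Vv)[c [cF vE]]] := eP.
exists [ffun i => c i]; split=> [|c' [c'F vE']].
  by split=> [i|]; rewrite ?ffunE // vE; apply: eq_bigr => i _; rewrite ffunE.
apply/ffunP=> k; rewrite ffunE; apply/eqP; rewrite -subr_eq0; apply/negPn/negP => ck.
(* Two expansions of [v] that differ at [k] subtract to a nontrivial relation; dropping the [k]-th
   vector then contradicts the minimality of the length. *)
case: d => [|d] in e c c' cF c'F vE vE' eP dmin k ck *; first by case: k {ck}.
suff /dmin : P d by rewrite ltnn.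
apply/asboolP; exists (fun j => e (lift k j)).
apply: (@spans_lift F V d e (fun i => c i - c' i)) => // [i|].
  by apply: FD => //; apply: FN.
under eq_bigr do rewrite mulrBl.
by rewrite sumrB -vE -vE' subrr.
Qed.

Lemma lincomb_closed F V (I : finType) (c e : I -> K) : is_subspace F V ->
  (forall i, c i \in F) -> (forall i, e i \in V) -> \sum_i c i * e i \in V.
Proof.
by move=> [V0 VD VM] cF eV; elim/big_ind: _ => // i _; apply: VM.
Qed.

(** Enumerating [F] by ['I_q] turns coordinate vectors into functions from ['I_d] to ['I_q], and the
    basis property makes this a bijection onto [V]. *)
Lemma has_dim_card F V d q : is_subspace F V -> has_dim F V d ->
  F #= `I_q -> V #= `I_(q ^ d).
Proof.
move=> VP [e [eV eP]] /card_set_seqP[s [Us sq FE]].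
pose g (i : 'I_q) := nth 0 s i.
have gF i : g i \in F by rewrite FE in_setE /=; apply: mem_nth; rewrite sq.
have g_inj : injective g.
  by move=> i j /eqP; rewrite nth_uniq ?sq // => /eqP/val_inj.
have Fg x : x \in F -> exists i, x = g i.
  rewrite FE in_setE /= => xs; have lt_x : (index x s < q)%N by rewrite -sq index_mem.
  by exists (Ordinal lt_x); rewrite /g /= nth_index.
pose h (t : {ffun 'I_d -> 'I_q}) := \sum_(i < d) g (t i) * e i.
have hV t : h t \in V by apply: (@lincomb_closed F).
have -> : V = range h.
  apply/seteqP; split=> [v|_ [t _ <-]]; last by rewrite -in_setE.
  rewrite -in_setE => /eP[c [[cF ->] _]].
  have [t tP] := choice (fun i => Fg _ (cF i)).
  by exists (finfun t) => //; apply: eq_bigr => i _; rewrite ffunE tP.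
have h_inj : injective h.
  move=> t t' htt'; have [c [_ c_uniq]] := eP _ (hV t).
  have E1 := c_uniq [ffun i => g (t i)]; have E2 := c_uniq [ffun i => g (t' i)].
  have {}E1 : c = [ffun i => g (t i)].
    by apply: E1; split=> [i|]; rewrite ?ffunE //; apply: eq_bigr => i _; rewrite ffunE.
  have {}E2 : c = [ffun i => g (t' i)].
    by apply: E2; split=> [i|]; rewrite ?ffunE // htt'; apply: eq_bigr => i _; rewrite ffunE.
  apply/ffunP=> i; apply: g_inj.
  by have := congr1 (fun f : {ffun _} => f i) (etrans (esym E1) E2); rewrite !ffunE.
by have := card_range_fin h_inj; rewrite card_ffun !card_ord.
Qed.

(** * Generated subfields and rings of multipliers *)

Lemma smallest_subfield (A : set K) : is_subfield (smallest (@is_subfield K) A).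
Proof.
have sub x : (forall F, is_subfield F -> A `<=` F -> F x) -> x \in smallest (@is_subfield K) A.
  by move=> h; rewrite in_setE => F [Fs AF]; apply: h.
have sub' x : x \in smallest (@is_subfield K) A ->
    forall F, is_subfield F -> A `<=` F -> x \in F.
  by rewrite in_setE => h F Fs AF; rewrite in_setE; apply: h.
split.
- by apply: sub => F [F1 _ _] _; rewrite -in_setE.
- move=> x y /sub' hx /sub' hy; apply: sub => F Fs AF; have [_ FB _] := Fs.
  by rewrite -in_setE; apply: FB; [apply: hx|apply: hy].
- move=> x y /sub' hx /sub' hy; apply: sub => F Fs AF; have [_ _ Fd] := Fs.
  by rewrite -in_setE; apply: Fd; [apply: hx|apply: hy].
Qed.

Lemma prime_subfieldP : is_subfield (prime_subfield K).
Proof. exact: smallest_subfield. Qed.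

Lemma prime_subfield_sub F : is_subfield F -> prime_subfield K `<=` F.
Proof. by move=> Fs x; apply; split. Qed.

Lemma Fp_adjoinP (lam : K) : is_subfield (Fp_adjoin lam).
Proof. exact: smallest_subfield. Qed.

(** Only [lam] has to be tested, since every subfield contains the prime subfield. *)
Lemma Fp_adjoin_sub (lam : K) F : is_subfield F -> F lam -> Fp_adjoin lam `<=` F.
Proof.
move=> Fs Flam x; apply; split=> // y [/prime_subfield_sub|->//]; exact.
Qed.

Lemma Fp_adjoin_gen (lam : K) : Fp_adjoin lam lam.
Proof. by move=> F [_]; apply; right. Qed.

Lemma is_subspace_sub F F' V : F `<=` F' -> is_subspace F' V -> is_subspace F V.
Proof.
move=> FF' [V0 VD VM]; split=> // a v aF Vv; apply: VM => //.
by rewrite in_setE; apply: FF'; rewrite -in_setE.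
Qed.

(** Inverses are the only delicate point: multiplication by a nonzero multiplier is an injection of
    the finite set [V] into itself, hence onto. This reduces stability of [V] under all of
    [Fp_adjoin lam] to stability under [lam]. *)
Lemma multipliers_subfield V : finite_set V -> 0 \in V ->
  {in V &, forall u v, u - v \in V} ->
  is_subfield [set a | {in V, forall v, a * v \in V}].
Proof.
move=> /finite_seqP[s0 Vs0] V0 VB; set M := [set a | _].
pose s := undup s0; have Us : uniq s by apply: undup_uniq.
have Vs v : (v \in V) = (v \in s).
  by rewrite Vs0 mem_undup; apply/idP/idP; rewrite in_setE.
have MP a : a \in M <-> {in V, forall v, a * v \in V} by rewrite in_setE.
have MV a : a \in M -> a^-1 \in M.
  have [->|a0] := eqVneq a 0; first by rewrite invr0.
  move=> /MP Ma; apply/MP => v Vv.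
  have sub : {subset [seq a * u | u <- s] <= s}.
    by move=> _ /mapP[u us ->]; rewrite -Vs; apply: Ma; rewrite Vs.
  have : v \in [seq a * u | u <- s].
    have Uas : uniq [seq a * u | u <- s] by rewrite map_inj_uniq //; apply: mulfI.
    have [|_ ->] := uniq_min_size Uas sub; first by rewrite size_map.
    by rewrite -Vs.
  by move=> /mapP[u us ->]; rewrite mulKf // Vs.
split.
- by apply/MP => v; rewrite mul1r.
- move=> a b /MP Ma /MP Mb; apply/MP => v Vv; rewrite mulrBl.
  by apply: VB; [apply: Ma|apply: Mb].
- move=> a b /MP Ma /MV/MP Mb; apply/MP => v Vv; rewrite -mulrA.
  by apply: Ma; apply: Mb.
Qed.

(** * Finite subfields in characteristic p *)

Section PrimeCharacteristic.
Variables (p : nat) (hp : p \in [pchar K]).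

(** Fermat's little theorem, read in [K]. *)
Lemma natr_expp n : (n%:R : K) ^+ p = n%:R.
Proof. by rewrite -(pFrobenius_autE hp) pFrobenius_aut_nat. Qed.

Lemma prime_subfield_card : prime_subfield K #= `I_p.
Proof.
have p_pr := pcharf_prime hp.
pose h (i : 'I_p) : K := i%:R.
have hE n : exists i, h i = n%:R.
  exists (Ordinal (ltn_pmod n (prime_gt0 p_pr))); rewrite /h /=.
  by rewrite [in RHS](divn_eq n p) natrD natrM (pcharf0 hp) mulr0 add0r.
(* If [h i = h j] with [j < i], then [p] divides the positive number [i - j], which is below [p]. *)
have h_inj : injective h.
  suff H i j : h i = h j -> (i <= j)%N.
    by move=> i j hij; apply/val_inj/anti_leq; rewrite !H.
  move=> hij; rewrite leqNgt; apply/negP => ji.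
  have : (p %| i - j)%N by rewrite (dvdn_pcharf hp) natrB 1?ltnW // -/(h i) hij subrr.
  move=> /dvdn_leq; rewrite subn_gt0 => /(_ ji).
  by rewrite leqNgt (leq_ltn_trans (leq_subr _ _) (ltn_ord i)).
suff -> : prime_subfield K = range h by have := card_range_fin h_inj; rewrite card_ord.
apply/seteqP; split=> [|_ [i _ <-]]; last first.
  rewrite -in_setE /h; have [F0 F1 FD _ _] := subfieldE prime_subfieldP.
  by elim: {i}(i : nat) => // n IHn; rewrite -natr1; apply: FD.
apply: prime_subfield_sub.
have rP x : x \in range h <-> exists n, x = n%:R.
  rewrite in_setE; split=> [[i _ <-]|[n ->]]; first by exists i.
  by have [i <-] := hE n; exists i.
have rV x : x \in range h -> x^-1 \in range h.
  move=> /rP[n ->]; have [->|n0] := eqVneq (n%:R : K) 0.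
    by rewrite invr0; apply/rP; exists 0%N.
  (* By Fermat, the inverse of a nonzero [n] is its power of exponent [p - 2]. *)
  apply/rP; exists (n ^ p.-2)%N; rewrite natrX; apply: (mulfI n0).
  rewrite divff // -exprS; apply: (mulfI n0); rewrite -exprS mulr1.
  have p2 : p.-2.+2 = p by case: p p_pr => [|[|]].
  by rewrite p2 natr_expp.
split.
- by apply/rP; exists 1%N.
(* In characteristic [p], subtracting [n] is adding [n] times [p - 1]. *)
- move=> _ _ /rP[m ->] /rP[n ->]; apply/rP; exists (m + n * p.-1)%N.
  rewrite natrD natrM -subn1 natrB ?prime_gt0 // (pcharf0 hp) sub0r mulrN1; congr (_ - _).
- by move=> _ _ /rP[m ->] /rV/rP[n ->]; apply/rP; exists (m * n)%N; rewrite natrM.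
Qed.

Lemma subfield_finite_card F : is_subfield F -> finite_set F ->
  exists m, (0 < m)%N /\ F #= `I_(p ^ m).
Proof.
move=> Fs Ffin; have [F0 F1 FD FN [FM FV]] := subfieldE Fs.
have Fsp : is_subspace (prime_subfield K) F.
  by apply: is_subspace_sub (prime_subfield_sub Fs) _; split.
have [m Fm] := has_dim_finite prime_subfieldP Fsp Ffin.
have Fc := has_dim_card Fsp Fm prime_subfield_card.
(* Dimension 0 would leave a single element, but 0 and 1 are distinct. *)
exists m; split=> //; rewrite lt0n; apply/eqP => m0.
move: Fc; rewrite m0 expn0 => /card_set_seqP[s [_ + FE]].
case: s FE => [|x [|y s]] //= FE _.
move: F0 F1; rewrite FE !in_setE /= !mem_seq1 => /eqP<-.
by rewrite oner_eq0.
Qed.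

Lemma frobenius_fixed_subfield N : is_subfield [set x : K | x ^+ (p ^ N) = x].
Proof.
have frobB (x y : K) : (x - y) ^+ (p ^ N) = x ^+ (p ^ N) - y ^+ (p ^ N).
  elim: N => [|N IHN]; first by rewrite expn0 !expr1.
  by rewrite expnSr !exprM IHN -!(pFrobenius_autE hp) rmorphB.
split=> [|x y|x y]; rewrite !in_setE /=; first by rewrite expr1n.
  by move=> hx hy; rewrite frobB hx hy.
by move=> hx hy; rewrite exprMn exprVn hx hy.
Qed.

(** The field lies in the fixed field of a power of the Frobenius, whose elements are roots of
    ['X^q - 'X]. *)
Lemma Fp_adjoin_finite n (lam : K) : n.-primitive_root lam -> finite_set (Fp_adjoin lam).
Proof.
move=> lamP; have p_pr := pcharf_prime hp.
have n_gt0 := prim_order_gt0 lamP.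
(* The order of a primitive root of unity is never divisible by the characteristic. *)
have co_pn : coprime p n.
  by rewrite prime_coprime //; apply/negP => /(prim_root_pcharF lamP); rewrite hp.
(* By Euler's theorem [q] is 1 modulo [n], so the [q]-th power map fixes [lam]. *)
pose q := (p ^ totient n)%N.
have q_gt1 : (1 < q)%N by rewrite -(exp1n (totient n)) ltn_exp2r ?totient_gt0 ?prime_gt1.
have lamq : lam ^+ q = lam.
  by rewrite -(prim_expr_mod lamP) Euler_exp_totient // (prim_expr_mod lamP) expr1.
have sub := Fp_adjoin_sub (frobenius_fixed_subfield (totient n)) lamq.
apply: (sub_finite_set sub).
(* An infinite fixed field would supply at least [q + 1] distinct roots of a polynomial of degree
   [q]. *)
apply: contrapT => /(@infinite_set_fset _ _ q.+1)[A AM szA].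
have Xq0 : 'X^q - 'X != 0 :> {poly K}.
  by rewrite -size_poly_eq0 size_polyDl ?size_polyXn // size_polyN size_polyX ltnS.
have : all (root ('X^q - 'X)) (finmap.enum_fset A).
  apply/allP => x /AM /= xq.
  by rewrite rootE !hornerE xq subrr.
move=> /(max_poly_roots Xq0)/(_ (finmap.fset_uniq A)).
by rewrite size_polyDl ?size_polyXn ?size_polyN ?size_polyX // ltnS leqNgt => /negP[].
Qed.

End PrimeCharacteristic.
End Subspaces.

(** * Affine coordinates on the automorphism group *)

Section Automorphisms.
Variable K : fieldType.
Implicit Types (f g : polyAut K) (V : set K).

Lemma polyAutE f q : f q = q \Po f 'X.
Proof.
have [fL [f1 fM] _] := polyAutP f; elim/poly_ind: q => [|q c IHq].
  (* Linearity with scalar -1 at zero vectors yields [f 0 = 0]. *)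
  have := fL (-1) 0 0; rewrite scaler0 addr0 => ->.
  by rewrite scaleN1r addNr comp_poly0.
rewrite comp_poly_MXaddC -IHq -fM addrC -[c%:P]mulr1 mul_polyC fL f1 addrC.
by rewrite -mul_polyC mulr1.
Qed.

Definition lin f : K := (f 'X)`_1.
Definition cst f : K := (f 'X)`_0.

(** Degrees multiply under composition, and composing with the inverse gives ['X], of degree 1. *)
Lemma polyAut_size f : size (f 'X) = 2%N.
Proof.
have [g [_ fgK]] := polyAut_inv_subproof f.
have /(congr1 (fun q : {poly K} => (size q).-1)) := fgK 'X.
rewrite (polyAutE f) size_comp_poly size_polyX => /eqP.
by rewrite muln_eq1 => /andP[_]; case: size => [|[|[|]]].
Qed.

Lemma polyAutX f : f 'X = lin f *: 'X + (cst f)%:P.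
Proof.
apply/polyP => i; rewrite coefD coefZ coefX coefC.
case: i => [|[|i]] /=; rewrite ?mulr0 ?add0r ?mulr1 ?addr0 //.
by rewrite nth_default // polyAut_size.
Qed.

Lemma lin_neq0 f : lin f != 0.
Proof.
have : lead_coef (f 'X) != 0 by rewrite lead_coef_eq0 -size_poly_eq0 polyAut_size.
by rewrite lead_coefE polyAut_size.
Qed.

Lemma polyAut_eq f g : lin f = lin g -> cst f = cst g -> f = g.
Proof.
by move=> l c; apply: polyAut_ext => q; rewrite !(polyAutE _ q) !polyAutX l c.
Qed.

(** The product applies [f] to [g 'X], so the slope of the right factor scales the constant of the
    left one. *)
Lemma polyAut_mulX f g : (f * g)%g 'X = (lin f * lin g) *: 'X + (lin g * cst f + cst g)%:P.
Proof.
rewrite -[LHS]/(f (g 'X)) polyAutE (polyAutX g) comp_polyD comp_polyZ comp_polyX comp_polyC.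
by rewrite polyAutX scalerDr scalerA (mulrC (lin g)) -addrA polyCD polyCM mul_polyC.
Qed.

Lemma coef_linear (a b : K) : ((a *: 'X + b%:P)`_1 = a) * ((a *: 'X + b%:P)`_0 = b).
Proof. by rewrite !coefE /= !mulr1 !mulr0 add0r addr0. Qed.

Lemma linM f g : lin (f * g)%g = lin f * lin g.
Proof. by rewrite /lin polyAut_mulX !coef_linear. Qed.

Lemma cstM f g : cst (f * g)%g = lin g * cst f + cst g.
Proof. by rewrite /cst polyAut_mulX !coef_linear. Qed.

Lemma lin1 : lin 1%g = 1.
Proof. by rewrite /lin -[(1%g : polyAut K) 'X]/'X coefX. Qed.

Lemma cst1 : cst 1%g = 0.
Proof. by rewrite /cst -[(1%g : polyAut K) 'X]/'X coefX. Qed.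

Lemma lin_sigma lam mu lam0 : lin (sigma lam mu lam0) = lam.
Proof. by rewrite /lin sigmaX coef_linear. Qed.

Lemma cst_sigma lam mu lam0 : cst (sigma lam mu lam0) = mu.
Proof. by rewrite /cst sigmaX coef_linear. Qed.

Lemma linV f : lin f^-1%g = (lin f)^-1.
Proof. by apply: (mulfI (lin_neq0 f)); rewrite -linM mulgV lin1 divff ?lin_neq0. Qed.

Lemma linX f i : lin (f ^+ i)%g = lin f ^+ i.
Proof. by elim: i => [|i IHi]; rewrite ?expg0 ?lin1 // expgS linM IHi exprS. Qed.

(* [shift nu f = 0] iff f fixes the point nu, in the sense that
   f 'X = lin f *: ('X - nu%:P) + nu%:P. *)
Definition shift nu f : K := cst f - (1 - lin f) * nu.

(** [shift nu] is [cst] in the coordinate ['X - nu%:P], so it obeys the rule of [cstM]. *)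
Lemma shiftM nu f g : shift nu (f * g)%g = lin g * shift nu f + shift nu g.
Proof. by rewrite /shift cstM linM; ring. Qed.

Lemma shift1 nu : shift nu 1%g = 0.
Proof. by rewrite /shift lin1 cst1 subrr mul0r subr0. Qed.

Lemma shiftV nu f : shift nu f^-1%g = - shift nu f / lin f.
Proof.
have := shiftM nu f f^-1%g; rewrite mulgV shift1 linV => /eqP.
by rewrite eq_sym addrC addr_eq0 => /eqP->; rewrite mulrC mulNr.
Qed.

Lemma shift_lin1 nu f : lin f = 1 -> shift nu f = cst f.
Proof. by rewrite /shift => ->; rewrite subrr mul0r subr0. Qed.

Lemma shift_translation nu v : shift nu (sigma 1 v (oner_neq0 K)) = v.
Proof. by rewrite shift_lin1 ?lin_sigma // cst_sigma. Qed.

Lemma shiftX0 nu f i : shift nu f = 0 -> shift nu (f ^+ i)%g = 0.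
Proof.
move=> f0; elim: i => [|i IHi]; first by rewrite expg0 shift1.
by rewrite expgS shiftM f0 IHi mulr0 addr0.
Qed.

Lemma shift_inj nu f g : lin f = lin g -> shift nu f = shift nu g -> f = g.
Proof. by move=> l; rewrite /shift l => /addIr c; apply: polyAut_eq. Qed.

(** Moving the base point changes the shift by a coboundary; this governs how far [nu] is unique. *)
Lemma shift_change nu nu' f : shift nu' f = shift nu f - (1 - lin f) * (nu' - nu).
Proof. by rewrite /shift; ring. Qed.

Lemma shift_sigma nu lam lam0 : shift nu (sigma lam ((1 - lam) * nu) lam0) = 0.
Proof. by rewrite /shift lin_sigma cst_sigma subrr. Qed.

Lemma translationsP V f : translations V f <-> lin f = 1 /\ V (cst f).
Proof.
split=> [[v Vv <-]|[l c]]; first by rewrite lin_sigma cst_sigma.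
by exists (cst f) => //; apply: polyAut_eq; rewrite ?lin_sigma ?cst_sigma.
Qed.

End Automorphisms.

(** * Closure properties of subgroups and generated subgroups *)

Section GeneratedSubgroups.
Variable gT : groupType.
Implicit Types (G : set gT) (x y : gT).

Lemma subgroupP G : is_subgroup G ->
  [/\ G 1%g, forall x y, G x -> G y -> G (x * y)%g, forall x, G x -> G x^-1%g &
      forall x i, G x -> G (x ^+ i)%g].
Proof.
move=> Gs; have [G1 _] := Gs.
have GM x y : G x -> G y -> G (x * y)%g.
  move=> /mem_set Gx /mem_set Gy; apply/set_mem.
  by have GM := group_closedM Gs; apply: GM.
have GV x : G x -> G x^-1%g.
  by move=> /mem_set Gx; apply/set_mem; have GV := group_closedV Gs; apply: GV.
move: G1; rewrite in_setE => G1; split=> // x i Gx.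
by elim: i => [|i IHi]; rewrite ?expg0 // expgS; apply: GM.
Qed.

Lemma is_subgroupP G : G 1%g -> (forall x y, G x -> G y -> G (x * y)%g) ->
  (forall x, G x -> G x^-1%g) -> is_subgroup G.
Proof.
move=> G1 GM GV; split=> [|x y]; rewrite !in_setE // => Gx Gy.
by apply: GM => //; apply: GV.
Qed.

Lemma gen_subgroup G : is_subgroup (gen G).
Proof.
apply: is_subgroupP => [H [/subgroupP[]]//|x y Gx Gy|x Gx] H [Hs GH].
- by have [_ HM _ _] := subgroupP Hs; apply: HM; [apply: Gx|apply: Gy].
- by have [_ _ HV _] := subgroupP Hs; apply: HV; apply: Gx.
Qed.

Lemma gen_expg x i : gen [set x] (x ^+ i)%g.
Proof. by move=> H [/subgroupP[_ _ _ HX] xH]; apply/HX/xH. Qed.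

End GeneratedSubgroups.

(** * Extensions of translation groups by cyclic groups *)

Section CyclicExtension.
Variables (K : fieldType) (n : nat) (lam : K) (lam0 : lam != 0).
Hypothesis lamP : n.-primitive_root lam.
Implicit Types (f g : polyAut K) (V : set K) (nu : K).

Local Notation s nu := (sigma lam ((1 - lam) * nu) lam0).
Local Notation Gbar nu := (gen [set s nu]).

Lemma lin_sigmaX nu i : lin (s nu ^+ i)%g = lam ^+ i.
Proof. by rewrite linX lin_sigma. Qed.

Lemma shift_sigmaX nu i : shift nu (s nu ^+ i)%g = 0.
Proof. by rewrite shiftX0 // shift_sigma. Qed.

Lemma cst_sigmaX nu i : cst (s nu ^+ i)%g = (1 - lam ^+ i) * nu.
Proof. by have /eqP := shift_sigmaX nu i; rewrite subr_eq0 lin_sigmaX => /eqP. Qed.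

Lemma prim_root_unity i : (lam ^+ i) ^+ n = 1.
Proof. by rewrite exprAC (prim_expr_order lamP) expr1n. Qed.

(** The two equations cut out a subgroup containing the generator. Conversely they force [lin f] to
    be a power of [lam], and [f] shares both coordinates with that power of the generator. *)
Lemma gen_sigmaP nu f : Gbar nu f <-> lin f ^+ n = 1 /\ shift nu f = 0.
Proof.
split=> [|[fn f0]]; last first.
  have [i fi] := prim_rootP lamP fn.
  suff -> : f = (s nu ^+ i)%g by apply: gen_expg.
  by apply: (@shift_inj _ nu); rewrite ?lin_sigmaX // f0 shift_sigmaX.
move=> /(_ [set g | lin g ^+ n = 1 /\ shift nu g = 0]); apply; split=> [|_ ->]; last first.
  by split; rewrite ?shift_sigma // lin_sigma (prim_expr_order lamP).
apply: is_subgroupP => /= [|x y [x1 x0] [y1 y0]|x [x1 x0]].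
- by rewrite lin1 expr1n shift1.
- by rewrite linM exprMn x1 y1 mulr1 shiftM x0 y0 mulr0 addr0.
- by rewrite linV exprVn x1 invr1 shiftV x0 oppr0 mul0r.
Qed.

Lemma gen_sigmaE nu : Gbar nu = range (fun i : 'I_n => (s nu ^+ i)%g).
Proof.
apply/seteqP; split=> [f /gen_sigmaP[fn f0]|_ [i _ <-]]; last exact: gen_expg.
have [i fi] := prim_rootP lamP fn; exists i => //.
by apply: (@shift_inj _ nu); rewrite ?lin_sigmaX // f0 shift_sigmaX.
Qed.

Lemma prim_root_expr_inj (i j : 'I_n) : lam ^+ i = lam ^+ j -> i = j.
Proof.
move=> /eqP; rewrite (eq_prim_root_expr lamP) !modn_small // => /eqP.
exact: val_inj.
Qed.

Lemma gen_sigma_card nu : Gbar nu #= `I_n.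
Proof.
rewrite gen_sigmaE -[X in `I_X](card_ord n); apply: card_range_fin => i j /(congr1 (@lin K)).
by rewrite !lin_sigmaX => /prim_root_expr_inj.
Qed.

Variable V : set K.
Hypothesis VP : is_subspace (Fp_adjoin lam) V.

Local Notation G nu := (set_mulg (translations V) (Gbar nu)).

(** Every [n]-th root of unity is a power of [lam], hence a scalar in [Fp_adjoin lam]. *)
Lemma subspace_scale_unity a v : a ^+ n = 1 -> V v -> V (a * v).
Proof.
move=> /(prim_rootP lamP)[i ->] Vv; have [_ _ VM] := VP.
rewrite -in_setE; apply: VM; rewrite ?in_setE //; elim: {i}(i : nat) => [|i IHi].
  by have [_ F1 _ _ _] := subfieldE (Fp_adjoinP lam); rewrite -in_setE.
have [_ _ _ _ [FM _]] := subfieldE (Fp_adjoinP lam).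
rewrite exprS -in_setE; apply: FM; rewrite in_setE //; exact: Fp_adjoin_gen.
Qed.

Lemma subspace_addN : [/\ V 0, forall u v, V u -> V v -> V (u + v) & forall v, V v -> V (- v)].
Proof.
have [V0 VD VM] := VP; rewrite in_setE in V0; split=> // [u v|v].
  by move=> /mem_set Vu /mem_set Vv; apply/set_mem/VD.
move=> /mem_set Vv; apply: set_mem; rewrite -mulN1r; apply: VM => //.
by have [_ F1 _ FN _] := subfieldE (Fp_adjoinP lam); apply: FN.
Qed.

(** Membership becomes a condition on coordinates, so group laws, normality and dependence on [nu]
    reduce to computations with [lin] and [shift]. *)
Lemma extensionP nu f : G nu f <-> lin f ^+ n = 1 /\ V (shift nu f).
Proof.
split=> [[t /translationsP[t1 Vt]] [g /gen_sigmaP[gn g0] <-]|[fn Vf]].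
  rewrite linM shiftM t1 g0 mul1r addr0 shift_lin1 //; split=> //.
  exact: subspace_scale_unity.
have [i fi] := prim_rootP lamP fn.
(* The power of the generator on the right multiplies the translation vector by [lin f], which the
   division compensates. *)
exists (sigma 1 (shift nu f / lin f) (oner_neq0 K)).
  apply/translationsP; rewrite lin_sigma cst_sigma mulrC; split=> //.
  by apply: subspace_scale_unity; rewrite // exprVn fn invr1.
exists (s nu ^+ i)%g; first exact: gen_expg.
apply: (@shift_inj _ nu); first by rewrite linM lin_sigma lin_sigmaX mul1r.
rewrite shiftM shift_sigmaX addr0 shift_translation lin_sigmaX -fi.
by rewrite mulrC divfK ?lin_neq0.
Qed.

Lemma extension_sdprod nu : is_sdprod (translations V) (Gbar nu) (G nu).
Proof.
have [V0 VD VN] := subspace_addN.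
have subTG f : translations V f -> G nu f.
  by move=> /translationsP[f1 Vf]; apply/extensionP; rewrite shift_lin1 // f1 expr1n.
split=> //.
- split; last exact: gen_subgroup.
  + apply: is_subgroupP => [|x y /extensionP[xn Vx] /extensionP[yn Vy]
                            |x /extensionP[xn Vx]]; apply/extensionP.
    * by rewrite lin1 shift1 expr1n.
    * rewrite linM exprMn xn yn mulr1 shiftM; split=> //.
      by apply: VD => //; apply: subspace_scale_unity.
    * rewrite linV exprVn xn invr1 shiftV mulrC; split=> //.
      by apply: subspace_scale_unity; [rewrite exprVn xn invr1|apply: VN].
  + apply: is_subgroupP => [|x y /translationsP[x1 Vx] /translationsP[y1 Vy]
                            |x /translationsP[x1 Vx]]; apply/translationsP.
    * by rewrite lin1 cst1.
    * by rewrite linM cstM x1 y1 !mul1r; split=> //; apply: VD.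
    * have x'1 : lin x^-1%g = 1 by rewrite linV x1 invr1.
      by split=> //; rewrite -(shift_lin1 0) // shiftV x1 divr1 shift_lin1 //; apply: VN.
(* Conjugating a translation by [g] multiplies its vector by [lin g], a root of unity preserving
   [V]. *)
- split=> // g u; rewrite !in_setE => /extensionP[gn Vg] /translationsP[u1 Vu].
  have ug1 : lin (u ^ g)%g = 1 by rewrite conjgE !linM linV u1 mul1r mulVf ?lin_neq0.
  apply/translationsP; split=> //; rewrite -(shift_lin1 nu ug1) conjgE.
  rewrite !shiftM linM u1 mul1r shiftV mulrCA divff ?lin_neq0 // mulr1.
  rewrite addrCA addNr addr0 (shift_lin1 nu u1); exact: subspace_scale_unity.
- apply/seteqP; split=> [f [/translationsP[f1 _] /gen_sigmaP[_ f0]]|_ ->].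
    by apply: (@shift_inj _ nu); rewrite ?lin1 ?shift1.
  by split; [apply/translationsP|apply/gen_sigmaP]; rewrite lin1 ?cst1 ?shift1 ?expr1n.
Qed.

Lemma mem_extension nu i v : V v -> G nu (s nu ^+ i * sigma 1 v (oner_neq0 K))%g.
Proof.
move=> Vv; apply/extensionP; rewrite linM shiftM shift_sigmaX mulr0 add0r lin_sigmaX lin_sigma.
by rewrite mulr1 prim_root_unity shift_translation.
Qed.

(** With the translation on the right, its vector is the shift itself, without rescaling. *)
Lemma extension_normal_form nu f : G nu f ->
  exists i : 'I_n, f = (s nu ^+ i * sigma 1 (shift nu f) (oner_neq0 K))%g.
Proof.
move=> /extensionP[/(prim_rootP lamP)[i fi] Vf]; exists i; apply: (@shift_inj _ nu).
  by rewrite linM lin_sigmaX lin_sigma mulr1.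
by rewrite shiftM shift_sigmaX mulr0 add0r shift_translation.
Qed.

(** The normal form is unique: [lin] determines the exponent below [n], and [shift nu] the
    vector. *)
Lemma extension_card nu N : V #= `I_N -> G nu #= `I_(n * N).
Proof.
move=> /card_set_seqP[r [Ur rN VE]].
pose h (u : 'I_n * 'I_N) := (s nu ^+ u.1 * sigma 1 (nth 0%R r u.2) (oner_neq0 K))%g.
have Vr (k : 'I_N) : V (nth 0 r k) by rewrite VE /=; apply: mem_nth; rewrite rN.
have -> : G nu = range h.
  apply/seteqP; split=> [f Gf|_ [u _ <-]]; last exact: mem_extension.
  have [i fE] := extension_normal_form Gf; have [_ ] := (extensionP nu f).1 Gf.
  rewrite VE /= => fr; have lt_f : (index (shift nu f) r < N)%N by rewrite -rN index_mem.
  by exists (i, Ordinal lt_f); rewrite // /h /= nth_index.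
rewrite -[X in `I_X](_ : #|{: 'I_n * 'I_N}| = _); last by rewrite card_prod !card_ord.
apply: card_range_fin => -[i k] [j l] hE.
have := congr1 (@lin K) hE; rewrite !linM !lin_sigmaX !lin_sigma !mulr1 /=.
move=> /prim_root_expr_inj ij.
move: (congr1 (shift nu) hE); rewrite !shiftM !shift_sigmaX !mulr0 !add0r /=.
rewrite !shift_translation => /eqP; rewrite nth_uniq ?rN //.
by move=> /eqP/val_inj kl; rewrite ij kl.
Qed.

End CyclicExtension.

Lemma fd_subspace_dims (K : fieldType) (p n : nat) (lam : K) (V : set K) :
  p \in [pchar K] -> n.-primitive_root lam -> is_fd_subspace (Fp_adjoin lam) V ->
  exists l m : nat,
    [/\ has_dim (prime_subfield K) V l,
        (0 < m)%N /\ Fp_adjoin lam #= `I_(p ^ m),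
        (m %| l)%N
      & V #= `I_(p ^ l)].
Proof.
move=> hp lamP [VP [d Vd]].
have Fs := Fp_adjoinP lam.
have [m [m_gt0 Fm]] := subfield_finite_card hp Fs (Fp_adjoin_finite hp lamP).
have Vc := has_dim_card VP Vd Fm; rewrite -expnM in Vc.
have VPp := is_subspace_sub (prime_subfield_sub Fs) VP.
have Vfin : finite_set V by apply/finite_setP; eexists; exact: Vc.
have [l Vl] := has_dim_finite (prime_subfieldP K) VPp Vfin.
have Vc' := has_dim_card VPp Vl (prime_subfield_card hp).
exists l, m; split=> //.
(* The two counts of [V] give [l = m * d]. *)
have /card_eq_II/eqP : `I_(p ^ l) #= `I_(p ^ (m * d)).
  by apply: card_eq_trans Vc; rewrite card_eq_sym.
by rewrite eqn_exp2l ?prime_gt1 ?(pcharf_prime hp) // => /eqP->; apply: dvdn_mulr.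
Qed.

(** * Structure of finite subgroups *)

Section FiniteSubgroups.
Variables (K : fieldType) (G : set (polyAut K)).
Hypotheses (Gs : is_subgroup G) (Gfin : finite_set G).

Lemma linear_parts_cyclic : exists n (lam : K),
  n.-primitive_root lam /\ forall x, (@lin K @` G) x <-> x ^+ n = 1.
Proof.
have [G1 GM _ _] := subgroupP Gs.
have /finite_seqP[r0 AE] : finite_set (@lin K @` G) by apply: finite_image.
pose r := undup r0; have Ur : uniq r := undup_uniq r0.
have rP x : x \in r <-> (@lin K @` G) x by rewrite AE mem_undup.
have r1 : 1 \in r by apply/rP; exists 1%g; rewrite ?lin1.
have r_gt0 : (0 < size r)%N by case: (r) r1.
have r0' x : x \in r -> x != 0 by move=> /rP[f _ <-]; apply: lin_neq0.
(* Multiplication by [x] permutes [r]; comparing the products of all elements before and after gives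
   [x ^+ size r = 1]. *)
have r_unity x : x \in r -> x ^+ size r = 1.
  move=> xr; have Uxr : uniq [seq x * y | y <- r].
    by rewrite map_inj_uniq //; apply/mulfI/r0'.
  have sub : {subset [seq x * y | y <- r] <= r}.
    move=> _ /mapP[y /rP[g Gg <-] ->]; have /rP[f Gf <-] := xr.
    by apply/rP; exists (f * g)%g; [apply: GM|rewrite linM].
  have [|_ xrE] := uniq_min_size Uxr sub; first by rewrite size_map.
  have /(perm_big _) E : perm_eq [seq x * y | y <- r] r by apply: uniq_perm.
  have prod0 : \prod_(y <- r) y != 0.
    by rewrite prodf_seq_neq0; apply/allP => y /r0' ->.
  apply: (mulIf prod0); rewrite mul1r -[RHS](E _ _ _ xpredT id) big_map big_split /=.
  by rewrite big_const_seq count_predT iter_mulr_1.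
have r_all : all (size r).-unity_root r.
  by apply/allP => x /r_unity xn; apply/unity_rootP.
(* A field containing [size r] distinct roots of unity of that order has a primitive one among
   them. *)
have /hasP[lam lamr lamP] := has_prim_root r_gt0 r_all Ur (leqnn _).
exists (size r), lam; split=> // x; rewrite -rP; split; first exact: r_unity.
move=> /(prim_rootP lamP)[i ->]; have /rP[f Gf <-] := lamr.
by apply/rP; exists (f ^+ i)%g; rewrite ?linX //; have [_ _ _] := subgroupP Gs; apply.
Qed.

Lemma finite_subgroup_structure :
  exists n (lam : K) (lam0 : lam != 0) V (nu : K),
    [/\ n.-primitive_root lam, is_fd_subspace (Fp_adjoin lam) V,
        G `&` Sh K = translations V
      & G = set_mulg (translations V) (gen [set sigma lam ((1 - lam) * nu) lam0])].
Proof.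
have [n [lam [lamP linG]]] := linear_parts_cyclic.
have [G1 GM GV GX] := subgroupP Gs.
have [s1 Gs1 lin_s1] : (@lin K @` G) lam by apply/linG/(prim_expr_order lamP).
have lam0 : lam != 0 by rewrite -lin_s1 lin_neq0.
(* For [lam = 1] the generator is the identity. Otherwise [nu] solves [(1 - lam) * nu = cst s1],
   making [s1] itself the generator. *)
have [nu Gs0] : exists nu, G (sigma lam ((1 - lam) * nu) lam0).
  have [lam1|lam1] := eqVneq lam 1.
    exists 0; suff -> : sigma lam ((1 - lam) * 0) lam0 = 1%g by [].
    by apply: polyAut_eq; rewrite ?lin_sigma ?cst_sigma ?lin1 ?cst1 // mulr0.
  exists (cst s1 / (1 - lam)); set mu := _ * _.
  suff <- : s1 = sigma lam mu lam0 by [].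
  apply: polyAut_eq; rewrite ?lin_sigma ?cst_sigma // /mu mulrC divfK //.
  by rewrite subr_eq0 eq_sym.
pose V := [set v | G (sigma 1 v (oner_neq0 K))].
have translE f : lin f = 1 -> f = sigma 1 (cst f) (oner_neq0 K).
  by move=> f1; apply: polyAut_eq; rewrite ?lin_sigma ?cst_sigma.
have VG f : lin f = 1 -> V (cst f) <-> G f.
  by move=> /translE fE; rewrite /V /= -fE.
have V0 : V 0 by rewrite -(cst1 K) VG ?lin1.
have VB u v : V u -> V v -> V (u - v).
  move=> Vu Vv; set su := sigma 1 u (oner_neq0 K); set sv := sigma 1 v (oner_neq0 K).
  have -> : u - v = cst (su * sv^-1)%g.
    rewrite -(shift_lin1 0) ?linM ?linV ?lin_sigma ?invr1 ?mulr1 //.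
    by rewrite shiftM shiftV linV !shift_translation !lin_sigma invr1 mul1r mulr1.
  rewrite VG ?linM ?linV ?lin_sigma ?invr1 ?mulr1 //; apply: GM => //; exact: GV.
have Vfin : finite_set V.
  apply: (@sub_finite_set _ _ (@cst K @` G)); last exact: finite_image.
  by move=> v Vv; exists (sigma 1 v (oner_neq0 K)); rewrite ?cst_sigma.
have V0' : 0 \in V by rewrite in_setE.
have VB' : {in V &, forall u v, u - v \in V}.
  by move=> u v; rewrite !in_setE; apply: VB.
have Ms := multipliers_subfield Vfin V0' VB'.
(* Conjugating the translation by [v] with [s0] gives the translation by [lam * v]. *)
have Mlam : {in V, forall v, lam * v \in V}.
  move=> v; rewrite !in_setE => Vv; set sv := sigma 1 v (oner_neq0 K).
  set s0 := sigma lam _ lam0 in Gs0.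
  have l1 : lin (s0^-1 * (sv * s0))%g = 1.
    by rewrite !linM linV !lin_sigma mul1r mulVf.
  have -> : lam * v = cst (s0^-1 * (sv * s0))%g.
    rewrite -(shift_lin1 nu l1) shiftM shiftV shiftM shift_sigma oppr0 mul0r mulr0 add0r addr0.
    by rewrite shift_translation lin_sigma.
  by rewrite VG //; apply: (GM); [apply: GV|apply: GM].
have VP : is_subspace (Fp_adjoin lam) V.
  split=> // [u v|a v].
    move=> Vu Vv; rewrite -[v]opprK; apply: (VB') => //.
    by rewrite -sub0r; apply: VB'.
  move=> /set_mem/(Fp_adjoin_sub Ms Mlam) /= Ma; exact: Ma.
exists n, lam, lam0, V, nu; split=> //.
- by split=> //; apply: has_dim_finite => //; apply: Fp_adjoinP.
- apply/seteqP; split=> f.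
    by move=> [Gf /translationsP[f1 _]]; apply/translationsP; split=> //; apply/VG.
  move=> /translationsP[f1 Vf]; split; first exact/VG.
  exact/translationsP.
apply/seteqP; split=> f.
  move=> Gf; have fn : lin f ^+ n = 1 by apply/linG; exists f.
  apply/(extensionP lam0 lamP VP); split=> //; have [i fi] := prim_rootP lamP fn.
  set s0 := sigma lam _ lam0 in Gs0.
  (* Dividing [f] by the power of [s0] with the same linear part leaves a translation in [G], whose
     vector is [shift nu f]. *)
  have l1 : lin ((s0 ^+ i)^-1 * f)%g = 1.
    by rewrite linM linV linX lin_sigma -fi mulVf ?lin_neq0.
  have -> : shift nu f = cst ((s0 ^+ i)^-1 * f)%g.
    rewrite -(shift_lin1 nu l1) shiftM shiftV (shiftX0 _ (shift_sigma _ _)).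
    by rewrite oppr0 mul0r mulr0 add0r.
  by rewrite VG //; apply: GM => //; apply/GV/GX.
move=> Gf; have [_ Vf] := (extensionP lam0 lamP VP nu f).1 Gf.
have [i ->] := extension_normal_form lamP VP Gf.
by apply: GM => //; apply: GX.
Qed.

End FiniteSubgroups.

(** In (iii) the comparison is equality of subgroups: for any [nu] and [nu'] the two groups are
    conjugate by a translation, hence always abstractly isomorphic. The converse there assumes
    [1 < n], since for [n = 1] the generator is the identity whatever [nu] is. *)
Theorem theorem4p3 (K : fieldType) (p : nat) (hp : p \in [pchar K]) :
  (* (i) *)
  (forall G : set (polyAut K), is_subgroup G -> finite_set G ->
    exists (n : nat) (lam : K) (lam0 : lam != 0) (V : set K) (nu : K),
      let Gbar := gen [set sigma lam ((1 - lam) * nu) lam0] in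
      [/\ n.-primitive_root lam,
          is_fd_subspace (Fp_adjoin lam) V,
          G `&` Sh K = translations V,
          Gbar #= `I_n
        & is_sdprod (G `&` Sh K) Gbar G] /\
      exists l m : nat,
        [/\ has_dim (prime_subfield K) V l,
            (0 < m)%N /\ Fp_adjoin lam #= `I_(p ^ m),
            (m %| l)%N
          & G #= `I_(n * p ^ l)]) /\
  (forall (n : nat) (lam : K) (lam0 : lam != 0) (V : set K),
    n.-primitive_root lam -> is_fd_subspace (Fp_adjoin lam) V ->
    let Gt := translations V in
    let s (nu : K) := sigma lam ((1 - lam) * nu) lam0 in
    let Gbar (nu : K) := gen [set s nu] in
    let G (nu : K) := set_mulg Gt (Gbar nu) in
    [/\ (* (ii) *)
        forall nu : K,
          [/\ is_sdprod Gt (Gbar nu) (G nu), finite_set (G nu)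
            & exists l m : nat,
                [/\ has_dim (prime_subfield K) V l,
                    (0 < m)%N /\ Fp_adjoin lam #= `I_(p ^ m),
                    (m %| l)%N
                  & G nu #= `I_(n * p ^ l)]],
        (* (iii) *)
        forall nu nu' : K,
          (nu' - nu \in V -> G nu = G nu') /\
          ((1 < n)%N -> (G nu = G nu' <-> nu' - nu \in V))
      & (* (iv) *)
        forall nu : K,
          G nu = [set (s nu ^+ i * sigma 1 v (oner_neq0 K))%g
                    | i in `I_n & v in V] /\
          forall (i : nat) (v : K), (i < n)%N -> v \in V ->
            (s nu ^+ i * sigma 1 v (oner_neq0 K))%g =
              (sigma (lam ^+ i) ((1 - lam ^+ i) * nu) (expf_neq0 i lam0)
                 * sigma 1 v (oner_neq0 K))%g /\
            (s nu ^+ i * sigma 1 v (oner_neq0 K))%g 'X =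
              lam ^+ i *: 'X + ((1 - lam ^+ i) * nu + v)%:P]).
Proof.
split=> [G Gs Gfin|n lam lam0 V lamP Vfd Gt s Gbar G].
  have [n [lam [lam0 [V [nu [lamP Vfd GSh GE]]]]]] := finite_subgroup_structure Gs Gfin.
  have [VP _] := Vfd; have [l [m [Vl Fm ml Vc]]] := fd_subspace_dims hp lamP Vfd.
  exists n, lam, lam0, V, nu; split.
    split=> //; first exact: gen_sigma_card.
    by rewrite GSh GE; exact: (extension_sdprod lam0 lamP VP).
  by exists l, m; split=> //; rewrite GE; apply: extension_card.
have [VP _] := Vfd; have [l [m [Vl Fm ml Vc]]] := fd_subspace_dims hp lamP Vfd.
have [V0 VD VN] := subspace_addN VP.
have memG nu f : G nu f <-> lin f ^+ n = 1 /\ V (shift nu f) by apply: extensionP.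
(* One inclusion suffices, as [V] is stable under negation and the roles of [nu] and [nu'] can be
   exchanged. *)
have GE nu nu' : V (nu' - nu) -> G nu `<=` G nu'.
  move=> Vnu f /memG[fn Vf]; apply/memG; split=> //.
  rewrite (shift_change nu) mulrBl mul1r opprB; apply: (VD) => //; apply: VD.
    exact: (subspace_scale_unity lamP VP fn Vnu).
  exact: VN.
split=> [nu|nu nu'|nu].
- have Gc : G nu #= `I_(n * p ^ l) by apply: extension_card.
  split; first exact: (extension_sdprod lam0 lamP VP).
    by apply/finite_setP; eexists; exact: Gc.
  by exists l, m.
- have imp : nu' - nu \in V -> G nu = G nu'.
    rewrite in_setE => Vnu; apply/seteqP; split; apply: GE => //.
    by rewrite -opprB; apply: VN.
  split=> // n_gt1; split=> // GG.
  have lam1 : 1 - lam != 0.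
    rewrite subr_eq0 eq_sym -[lam]expr1 -(prim_order_dvd lamP) dvdn1.
    by rewrite neq_ltn n_gt1 orbT.
  (* Testing the equality on the generator puts [(1 - lam) * (nu' - nu)] in [V]; the factor
     [1 - lam] is then inverted inside [Fp_adjoin lam]. *)
  have /memG[_] : G nu' (s nu).
    by rewrite -GG; apply/memG; rewrite lin_sigma shift_sigma (prim_expr_order lamP).
  rewrite (shift_change nu) shift_sigma lin_sigma sub0r => /VN; rewrite opprK => Vd.
  have [_ _ VM] := VP; have [_ F1 FD FN [_ FV]] := subfieldE (Fp_adjoinP lam).
  rewrite -[nu' - nu](mulKf lam1); apply: VM; last by rewrite in_setE.
  apply: FV; apply: FD => //; apply: FN; rewrite in_setE; exact: Fp_adjoin_gen.
- split=> [|i v _ _].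
    apply/seteqP; split=> [f Gf|_ [i _ [v Vv <-]]]; last exact: (mem_extension lam0 lamP VP).
    have [i fE] := extension_normal_form lamP VP Gf; have [_ Vf] := (memG _ _).1 Gf.
    by exists i; [exact: ltn_ord|exists (shift nu f)].
  have sE : (s nu ^+ i)%g = sigma (lam ^+ i) ((1 - lam ^+ i) * nu) (expf_neq0 i lam0).
    by apply: polyAut_eq; rewrite ?lin_sigmaX ?cst_sigmaX ?lin_sigma ?cst_sigma.
  split; first by rewrite sE.
  by rewrite polyAutX linM cstM lin_sigmaX cst_sigmaX !lin_sigma !cst_sigma mulr1 mul1r.
Qed.
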